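(* Let $k\ge 1$ and $n>k+1$ be integers. Then $$ \tau_{n,k}\leq \frac{(2k-1)!!}{(n+k-1)(n+k-3)\cdots(n-k+1)}\,\Big(\frac{n}{k+2}\Big)^{k}. $$
   Context: $T_n$ is the $n$-th Chebyshev polynomial of the first kind, $T_n(\cos\theta)=\cos n\theta$, and $T_n^{(k)}$ is its $k$-th derivative. For integers $k\ge1$ and $n\geq k+2$, $\omega_{n,k}$ denotes the largest (rightmost) zero of the polynomial $T_n^{(k+1)}$ (all of whose zeros are real and lie in $(-1,1)$), and $$\tau_{n,k}:=\frac{|T_n^{(k)}(\omega_{n,k})|}{T_n^{(k)}(1)}.$$ Notation: $(2k-1)!!=1\cdot3\cdots(2k-1)$. The product $(n+k-1)(n+k-3)\cdots(n-k+1)$ has $k$ factors decreasing in steps of $2$, i.e. it equals $\prod_{j=1}^{k}(n+k+1-2j)$. *)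

(* Defs.v *)
From mathcomp Require Import all_boot all_order all_algebra.
From mathcomp Require Import all_classical all_reals all_analysis.
From mathcomp Require Import ring.
From mathcomp Require polyrcf.

Set Implicit Arguments.
Unset Strict Implicit.
Unset Printing Implicit Defensive.

Import Order.TTheory GRing.Theory Num.Theory.
Local Open Scope ring_scope.

Definition is_chebyshev (R : realType) (n : nat) (p : {poly R}) : Prop :=
  forall theta : R, p.[cos theta] = cos (n%:R * theta).

Lemma chebyshev_exists (R : realType) (n : nat) :
  exists p : {poly R}, is_chebyshev n p.
Proof.
suff [p [q [Hp _]]] : exists p q : {poly R},
    is_chebyshev n p /\ is_chebyshev n.+1 q by exists p.
elim: n => [|n [p [q [Hp Hq]]]].
  exists 1, 'X; split=> t; first by rewrite hornerE mul0r cos0.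
  by rewrite hornerX mul1r.
exists q, (2%:P * 'X * q - p); split=> // t.
rewrite !hornerE Hp Hq.
have -> : n.+2%:R * t = n.+1%:R * t + t.
  by rewrite -[n.+2%:R]natr1 mulrDl mul1r.
have -> : n%:R * t = n.+1%:R * t - t.
  by rewrite -[n.+1%:R]natr1 mulrDl mul1r addrK.
by rewrite cosB cosD; ring.
Qed.

(* Fully determined by its specification, see [is_chebyshev_unique]. *)
Definition chebyshevT (R : realType) (n : nat) : {poly R} :=
  sval (cid (chebyshev_exists R n)).

Lemma chebyshevTP (R : realType) (n : nat) : is_chebyshev n (chebyshevT R n).
Proof. exact: svalP (cid (chebyshev_exists R n)). Qed.

Lemma is_chebyshev_unique (R : realType) (n : nat) (p q : {poly R}) :
  is_chebyshev n p -> is_chebyshev n q -> p = q.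
Proof.
move=> Hp Hq; apply/eqP; rewrite -subr_eq0; apply/negP => /negP nz.
pose s := [seq (i.+1%:R : R)^-1 | i <- iota 0 (size (p - q))].
have /(max_poly_roots nz) : all (root (p - q)) s.
  apply/allP => _ /mapP[i _ ->]; rewrite rootE.
  have i1 : (i.+1%:R : R)^-1 \in `[(-1), 1].
    rewrite in_itv /= invf_le1 ?ltr0n // ler1n andbT.
    by rewrite (le_trans _ (_ : 0 <= _)) // ?invr_ge0 ?ler0n // oppr_le0 ler01.
  by rewrite -(acosK i1) !hornerE Hp Hq subrr.
rewrite size_map size_iota ltnn => /(_ _)/negP; apply=> //.
rewrite map_inj_uniq ?iota_uniq // => i j /invr_inj/eqP.
by rewrite eqr_nat eqSS => /eqP.
Qed.

Definition is_largest_zero (R : realType) (p : {poly R}) (w : R) : Prop :=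
  root p w /\ forall z : R, root p z -> z <= w.

(* The default value 0 is only taken when the polynomial has no largest zero;
   [omegaP] below shows that this does not happen when k + 2 <= n. *)
Definition omega (R : realType) (n k : nat) : R :=
  xget 0 [set w | is_largest_zero (chebyshevT R n)^`(k.+1) w]%classic.

Definition tau (R : realType) (n k : nat) : R :=
  `|(chebyshevT R n)^`(k).[omega R n k]| / (chebyshevT R n)^`(k).[1].

Definition odd_double_factorial (k : nat) : nat :=
  \prod_(1 <= j < k.+1) (2 * j - 1).

Lemma rolle_path (R : realType) (p : {poly R}) (x : R) (s : seq R) :
  path >%R x s -> all (root p) (x :: s) ->
  exists t, [/\ size t = size s, path >%R x t & all (root p^`()) t].
Proof.
elim: s x => [|y s IH] x; first by exists [::].
rewrite [path _ _ _]/= => /andP[yx ys] /= /and3P[px py ps].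
have [|t [st pt rt]] := IH y ys; first by rewrite /= py.
have [|c /= cyx rc] := polyrcf.poly_rolle yx (p := p).
  by rewrite (rootP px) (rootP py).
move: cyx; rewrite in_itv /= => /andP[yc cx].
exists (c :: t); split; rewrite /= ?st //.
  rewrite cx /=; apply: (path_le (leT := >%R)) yc pt.
  by move=> a b d /= ba ad; apply: lt_trans ad ba.
by rewrite rt andbT rootE rc.
Qed.

Lemma chebyshevT_roots (R : realType) (n : nat) :
  exists s : seq R, [/\ size s = n, sorted >%R s & all (root (chebyshevT R n)) s].
Proof.
have [->|n0] := posnP n; first by exists [::].
have npos : (0 : R) < n%:R by rewrite ltr0n.
pose a (j : nat) : R := (pi / 2 + pi *+ j) / n%:R.
have a_lt : {homo a : i j / (i < j)%N >-> i < j}.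
  move=> i j ij; rewrite /a ltr_pM2r ?invr_gt0 // ltrD2l.
  by rewrite -[pi *+ i]mulr_natr -[pi *+ j]mulr_natr ltr_pM2l ?pi_gt0 // ltr_nat.
have a_in j : (j < n)%N -> a j \in `[0, pi].
  move=> jn; have p0 : 0 <= pi / 2 + pi *+ j :> R.
    by apply: addr_ge0; [apply: divr_ge0 | apply: mulrn_wge0]; rewrite // pi_ge0.
  rewrite in_itv /= (divr_ge0 p0) ?ler0n //=.
  rewrite ler_pdivrMr //.
  apply: (@le_trans _ _ (pi *+ j.+1)); last first.
    by rewrite -[leLHS]mulr_natr ler_wpM2l ?pi_ge0 // ler_nat.
  by rewrite [leRHS]mulrS lerD2r ler_pdivrMr ?ltr0n // ler_peMr ?pi_ge0 ?ler1n.
exists [seq cos (a j) | j <- iota 0 n]; split.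
- by rewrite size_map size_iota.
- rewrite sorted_map; apply: (@sub_in_sorted _ (fun j => (j < n)%N) ltn).
  + move=> i j ij jn lij /=; rewrite ltr_cos ?a_in //; exact: a_lt.
  + by apply/allP => i; rewrite mem_iota.
  + exact: iota_ltn_sorted.
- apply/allP => _ /mapP[j _ ->]; rewrite rootE chebyshevTP.
  have -> : n%:R * a j = pi / 2 + pi *+ j.
    by rewrite /a mulrC divfK // gt_eqF.
  rewrite (alternatingn (@cosDpi R)).
  by rewrite cos_pihalf mulr0.
Qed.

Lemma chebyshevT_derivn_roots (R : realType) (n k : nat) :
  exists s : seq R, [/\ size s = (n - k)%N, sorted >%R s &
                all (root (chebyshevT R n)^`(k)) s].
Proof.
elim: k => [|k [s [ss sor rs]]].
  by have [s] := chebyshevT_roots R n; exists s; rewrite subn0.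
case: s ss sor rs => [|x s] ss sor rs.
  by exists [::]; split=> //=; rewrite subnS -ss.
have [t [st pt rt]] := rolle_path sor rs.
exists t; rewrite derivnS; split=> //; first by rewrite st subnS -ss.
exact: path_sorted pt.
Qed.

Lemma chebyshevT_derivn_neq0 (R : realType) (n k : nat) :
  (k <= n)%N -> (chebyshevT R n)^`(k) != 0.
Proof.
move=> kn; set T := chebyshevT R n.
have T0 : T != 0.
  apply/eqP => T0; have := chebyshevTP (R := R) n 0.
  rewrite -/T T0 horner0 mulr0 cos0 => /eqP; by rewrite eq_sym oner_eq0.
have [s [ss sor rs]] := chebyshevT_roots R n.
have sT : (n < size T)%N.
  rewrite -ss; apply: max_poly_roots => //; apply: sorted_uniq sor.
    by move=> a b c /= ba ad; apply: lt_trans ad ba.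
  by move=> a /=; rewrite ltxx.
apply/eqP => /polyP/(_ ((size T).-1 - k)%N); rewrite coef0 coef_derivn.
have kT : (k <= (size T).-1)%N.
  by rewrite -ltnS prednK ?(leq_ltn_trans _ sT) // (leq_trans _ sT).
rewrite addnC subnK // => /eqP; rewrite mulrn_eq0 -/(lead_coef T) lead_coef_eq0.
by rewrite (negPf T0) orbF => /eqP f0; have := ffact_gt0 (size T).-1 k; rewrite f0 kT.
Qed.

Lemma largest_zero_exists (R : realType) (p : {poly R}) :
  p != 0 -> (exists x, root p x) -> exists w, is_largest_zero p w.
Proof.
move=> p0 [x px]; have mem z : (z \in polyrcf.rootsR p) = root p z.
  by rewrite -(polyrcf.roots_on_rootsR p0) in_itv.
exists (\big[Order.max/x]_(z <- polyrcf.rootsR p) z); split.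
  by rewrite big_seq; elim/big_ind: _ => // [u v pu pv|z]; rewrite ?mem // maxEle; case: ifP.
move=> z; rewrite -mem => zr; exact: le_bigmax_seq.
Qed.

Lemma omegaP (R : realType) (n k : nat) : (k.+1 < n)%N ->
  is_largest_zero (chebyshevT R n)^`(k.+1) (omega R n k).
Proof.
move=> kn; apply: (@xgetPex R 0 [set w | is_largest_zero _ w]%classic).
apply: largest_zero_exists; first exact/chebyshevT_derivn_neq0/ltnW.
have [[|x s] [ss _ rs]] := chebyshevT_derivn_roots R n k.+1.
  by move/eqP: ss; rewrite eq_sym subn_eq0 leqNgt kn.
by exists x; move: rs => /andP[].
Qed.

(* Main.v *)
Require Import Defs.
From mathcomp Require Import all_boot all_order all_algebra.
From mathcomp Require Import all_classical all_reals all_analysis.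
From mathcomp Require Import ring lra zify.
From mathcomp Require polyrcf polyorder.
Import Order.TTheory GRing.Theory Num.Theory.
Local Open Scope ring_scope.

(* Put f = T_n^(k), w = 1 - x^2 and u = w^(k/2) f.  In the variable
   x = cos t, u'' + phi u = 0 with phi = n^2 - k(k-1)/sin^2 t, so the energy
   phi u^2 + u'^2 increases up to t = pi/2; at a zero omega of f' this bounds
   f(omega)^2 w^(k-1) ((n^2-k^2) w + k) by the energy at x = 0, which is known
   in closed form.  It remains to bound omega away from 1.  Laguerre's
   inequality for the real-rooted polynomial T_n^(k+1) / (X - omega), combined
   with the differential equation at omega, gives
     omega^2 K <= 4 d (n^2 - (k+2)^2) (1 - omega^2),  d = n - k - 2,
   with K = (2k+3) (d (2k+11) + 3 (2k+3)).  This exceeds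
   1 - omega^2 >= ((k+2)/n)^2 by enough to absorb, through Bernoulli's
   inequality, the loss made in the energy at 0 when n - k is odd. *)

(** * Algebraic tools and the inequalities of Bernoulli and Laguerre *)

(** Lets [ring] prove an identity modulo a known equation [a = b]. *)
Lemma eq_from_sub {V : zmodType} {a b c d : V} : a = b -> c - d = a - b -> c = d.
Proof. by move=> ->; rewrite subrr => /eqP; rewrite subr_eq0 => /eqP. Qed.

Lemma bernoulli_ineq (R : realDomainType) (x : R) (k : nat) :
  -1 <= x -> 1 + k%:R * x <= (1 + x) ^+ k.
Proof.
move=> x1; elim: k => [|k IH]; first by rewrite mul0r addr0 expr0.
rewrite exprS -natr1; have k0 : 0 <= k%:R :> R := ler0n _ _.
have x0 : 0 <= 1 + x by lra.
apply: le_trans (ler_wpM2l x0 IH); rewrite -subr_ge0.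
have -> : (1 + x) * (1 + k%:R * x) - (1 + (k%:R + 1) * x) = k%:R * x ^+ 2 by ring.
by rewrite mulr_ge0 ?sqr_ge0.
Qed.

(** Induction on the roots: multiplied by d = [size s] > 0, the gap for (X - y) q is a square plus a
    nonnegative multiple of the gap for q. *)
Lemma laguerre_prod_XsubC (R : realFieldType) (s : seq R) (q : {poly R}) (x : R) :
  q = \prod_(z <- s) ('X - z%:P) ->
  (size s)%:R * (q.[x] * q^`()^`().[x]) <= ((size s)%:R - 1) * q^`().[x] ^+ 2.
Proof.
elim: s q => [|y s IH] p Hp /=.
  have -> : p = 1%:P by rewrite Hp big_nil.
  by rewrite derivC horner0; lra.
pose q : {poly R} := \prod_(z <- s) ('X - z%:P).
have {Hp} -> : p = ('X - y%:P) * q by rewrite Hp big_cons.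
have := IH q erefl.
rewrite !poly.derivE !hornerE /= -natr1.
have [s0|s_gt0] := posnP (size s).
  have -> : q = 1%:P by rewrite /q (size0nil s0) big_nil.
  rewrite derivC linear0 !hornerE s0 /=; lra.
have {s_gt0} : 0 < (size s)%:R :> R by rewrite ltr0n.
move: (size s)%:R (x - y) q.[x] q^`().[x] q^`()^`().[x] => d z a b c d0 H.
rewrite -subr_ge0 -(pmulr_rge0 _ d0).
rewrite [leRHS](_ : _ = (d * a - z * b) ^+ 2
    + (d + 1) * z ^+ 2 * ((d - 1) * b ^+ 2 - d * (a * c))); last by ring.
have {}H : 0 <= (d - 1) * b ^+ 2 - d * (a * c) by lra.
have d1 : 0 <= d + 1 by lra.
apply: addr_ge0; first exact: sqr_ge0.
by apply: mulr_ge0 => //; apply: mulr_ge0 => //; exact: sqr_ge0.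
Qed.

(** * Recurrence and differential equation of the Chebyshev polynomials *)

Lemma chebyshevT0 (R : realType) : chebyshevT R 0 = 1.
Proof.
apply: is_chebyshev_unique (@chebyshevTP R 0) _ => t.
by rewrite hornerE mul0r cos0.
Qed.

Lemma chebyshevT1 (R : realType) : chebyshevT R 1 = 'X.
Proof.
apply: is_chebyshev_unique (@chebyshevTP R 1) _ => t.
by rewrite hornerX mul1r.
Qed.

Lemma chebyshevTSS (R : realType) (n : nat) :
  chebyshevT R n.+2 = 2 * 'X * chebyshevT R n.+1 - chebyshevT R n.
Proof.
apply: is_chebyshev_unique (@chebyshevTP R n.+2) _ => t.
rewrite -[2]polyC_natr !hornerE !chebyshevTP -[n.+2%:R]natr1.
have -> : n%:R * t = n.+1%:R * t - t by rewrite -natr1; ring.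
by rewrite (mulrDl _ _ t) !mul1r cosB cosD; ring.
Qed.

Lemma size_chebyshevT (R : realType) (n : nat) :
  (size (chebyshevT R n) <= n.+1)%N.
Proof.
suff: (size (chebyshevT R n) <= n.+1)%N /\ (size (chebyshevT R n.+1) <= n.+2)%N.
  by case.
elim: n => [|n [IH0 IH1]].
  by rewrite chebyshevT0 chebyshevT1 size_poly1 size_polyX.
split=> //; rewrite chebyshevTSS (leq_trans (size_polyD _ _)) // size_polyN.
rewrite geq_max (leq_trans IH0) ?andbT; last by rewrite -addn3 -addn1 leq_add2l.
rewrite -mulrA mulr_natl mulr2n (leq_trans (size_polyD _ _)) // maxnn mulrC.
by rewrite (leq_trans (size_polyMleq _ _)) // size_polyX addn2.
Qed.

(** Two consecutive indices are carried together because the three-term recurrence calls on both. *)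
Lemma chebyshevT_deriv (R : realType) (n : nat) :
  (1 - 'X^2) * (chebyshevT R n)^`()
    = n%:R * ('X * chebyshevT R n - chebyshevT R n.+1)
  /\ (1 - 'X^2) * (chebyshevT R n.+1)^`()
    = n.+1%:R * (chebyshevT R n - 'X * chebyshevT R n.+1).
Proof.
elim: n => [|n [H0 H1]].
  by rewrite chebyshevT0 chebyshevT1 derivX -polyC1 (derivC (1 : R)) polyC1; split; ring.
split; first by rewrite H1 chebyshevTSS; ring.
rewrite chebyshevTSS; move: H0 H1.
have -> : (2 * 'X * chebyshevT R n.+1 - chebyshevT R n)^`()
  = 2 * chebyshevT R n.+1 + 2 * 'X * (chebyshevT R n.+1)^`()
    - (chebyshevT R n)^`().
  by rewrite -[2]polyC_natr !poly.derivE; ring.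
rewrite -[n.+2%:R]natr1 -[n.+1%:R]natr1.
move: (chebyshevT R n) (chebyshevT R n.+1) => T U H0 H1.
have -> : (1 - 'X^2) * (2 * U + 2 * 'X * U^`() - T^`())
  = 2 * (1 - 'X^2) * U + 2 * 'X * ((1 - 'X^2) * U^`()) - (1 - 'X^2) * T^`().
  by ring.
by rewrite H0 H1; ring.
Qed.

Lemma onesubX2_neq0 (R : realType) : 1 - 'X^2 != 0 :> {poly R}.
Proof.
apply/eqP => /(congr1 (fun p : {poly R} => p.[0])).
by rewrite !hornerE expr0n subr0 => /eqP; rewrite oner_eq0.
Qed.

(** The case k = 0 comes from differentiating the first-order relation of [chebyshevT_deriv]; each
    further k from differentiating the equation once. *)
Lemma chebyshevT_ode (R : realType) (n k : nat) :
  (1 - 'X^2) * (chebyshevT R n)^`(k.+2)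
    - (2 * k%:R + 1) * 'X * (chebyshevT R n)^`(k.+1)
    + (n%:R ^+ 2 - k%:R ^+ 2) * (chebyshevT R n)^`(k) = 0.
Proof.
elim: k => [|k IH].
  rewrite !derivnS derivn0; have [H0 H1] := chebyshevT_deriv R n.
  (* The extra factor 1 - X^2 lets the first-order relations eliminate the remaining first
     derivatives. *)
  apply/eqP; rewrite -(mulrI_eq0 _ (mulfI (onesubX2_neq0 R))); apply/eqP.
  have := congr1 (@deriv R) H0.
  rewrite -polyC_natr !poly.derivE polyC_natr.
  move: H0 H1; rewrite -[n.+1%:R]natr1.
  move: (chebyshevT R n) (chebyshevT R n.+1) => T U H0 H1 H2.
  have -> : (1 - 'X^2) * ((1 - 'X^2) * T^`()^`() - (2 * 0 + 1) * 'X * T^`()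
      + (n%:R ^+ 2 - 0 ^+ 2) * T)
    = (1 - 'X^2) * ((1 - 'X^2) * T^`()^`() - 2 * 'X * T^`())
      + 'X * ((1 - 'X^2) * T^`()) + n%:R ^+ 2 * (1 - 'X^2) * T by ring.
  have -> : (1 - 'X^2) * T^`()^`() - 2 * 'X * T^`()
    = n%:R * (T + 'X * T^`() - U^`()) by apply: (eq_from_sub H2); ring.
  have -> : (1 - 'X^2) * (n%:R * (T + 'X * T^`() - U^`()))
    = n%:R * ((1 - 'X^2) * T + 'X * ((1 - 'X^2) * T^`()) - (1 - 'X^2) * U^`()).
    by ring.
  by rewrite H0 H1; ring.
have := congr1 (@deriv R) IH; rewrite !derivnS.
set f := (chebyshevT R n)^`(k).
rewrite -!polyC_natr -!polyC1 -!polyC_exp -!(polyCM, polyCD, polyCN) !poly.derivE.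
rewrite -natr1 => H; rewrite -[RHS]H !(polyCM, polyCD, polyCN, polyC_exp, polyC_natr).
by ring.
Qed.

Lemma chebyshevT_ode_horner (R : realType) (n k : nat) (x : R) :
  (1 - x ^+ 2) * (chebyshevT R n)^`(k.+2).[x]
    - (2 * k%:R + 1) * x * (chebyshevT R n)^`(k.+1).[x]
    + (n%:R ^+ 2 - k%:R ^+ 2) * (chebyshevT R n)^`(k).[x] = 0.
Proof.
have := congr1 (fun p : {poly R} => p.[x]) (chebyshevT_ode R n k).
by rewrite -!polyC_natr !(hornerD, hornerN, hornerM, hornerC, hornerX, hornerXn,
  horner_exp, horner0).
Qed.

(** * Values of the derivatives at 1 and at 0 *)

Definition step2_prod {R : realType} (n k : nat) : R :=
  \prod_(1 <= j < k.+1) (n%:R + k%:R + 1 - 2 * j%:R).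

(** The longer product gains one factor at each end, n + k + 1 and n - k - 1. *)
Lemma step2_prodSS (R : realType) (n k : nat) :
  step2_prod n k.+2 = step2_prod n k * (n%:R ^+ 2 - k.+1%:R ^+ 2) :> R.
Proof.
rewrite /step2_prod big_nat_recr //= big_nat_recl //=.
rewrite (eq_bigr (fun j => n%:R + k%:R + 1 - 2 * j%:R)) => [|j _].
  by rewrite -!natr1; ring.
by rewrite -!natr1; ring.
Qed.

Lemma step2_prod_gt0 (R : realType) (n k : nat) :
  (k <= n)%N -> 0 < step2_prod n k :> R.
Proof.
move=> kn; rewrite /step2_prod big_nat; apply: prodr_gt0 => j /andP[_ jk].
have : j%:R <= k%:R :> R by rewrite ler_nat.
have : k%:R <= n%:R :> R by rewrite ler_nat.
by lra.
Qed.

(** Induction in steps of two, along [step2_prodSS]; the step amounts to (n^2 - k^2) (n^2 - (k+2)^2)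
    <= (n^2 - (k+1)^2)^2. *)
Lemma step2_prod_sqr_le (R : realType) (n k : nat) : (k <= n)%N ->
  step2_prod n k.+1 ^+ 2 <= (n%:R ^+ 2 - k%:R ^+ 2) * step2_prod n k ^+ 2 :> R.
Proof.
suff: ((k <= n)%N -> step2_prod n k.+1 ^+ 2
      <= (n%:R ^+ 2 - k%:R ^+ 2) * step2_prod n k ^+ 2 :> R)
  /\ ((k.+1 <= n)%N -> step2_prod n k.+2 ^+ 2
      <= (n%:R ^+ 2 - k.+1%:R ^+ 2) * step2_prod n k.+1 ^+ 2 :> R) by case.
elim: k => [|k [IH0 IH1]].
  rewrite step2_prodSS /step2_prod !big_nat1 !big_geq //.
  split=> n0; first by rewrite le_eqVlt; apply/orP; left; apply/eqP; ring.
  have : 1 <= n%:R :> R by rewrite ler1n.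
  move: (n%:R) => x x1; rewrite -subr_ge0.
  rewrite [leRHS](_ : _ = x ^+ 2 - 1); last by ring.
  by nra.
split=> // kn; have := IH0 (ltnW (ltnW kn)).
rewrite (step2_prodSS _ _ k) (step2_prodSS _ _ k.+1).
have : k.+2%:R <= n%:R :> R by rewrite ler_nat.
rewrite -[k.+2%:R]natr1 -[k.+1%:R]natr1; have : 0 <= k%:R :> R by [].
move: (k%:R) (n%:R) (step2_prod n k) (step2_prod n k.+1) => a x p q a0 ax.
move=> /(ler_wpM2r (sqr_ge0 (x ^+ 2 - (a + 1 + 1) ^+ 2))).
rewrite -exprMn => /le_trans; apply; rewrite -subr_ge0.
rewrite [leRHS](_ : _ = p ^+ 2 * (x ^+ 2 - (a + 1 + 1) ^+ 2)
   * (2 * (x ^+ 2 - (a + 1) ^+ 2) + (2 * a + 1) * (2 * a + 3))); last by ring.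
apply: mulr_ge0; first by apply: mulr_ge0; [exact: sqr_ge0 | nra].
by nra.
Qed.

Lemma chebyshevT_at1 (R : realType) (n : nat) : (chebyshevT R n).[1] = 1.
Proof. by have := @chebyshevTP R n 0; rewrite cos0 mulr0 cos0. Qed.

(** At x = 1 the second-order term of the differential equation vanishes; the double factorial
    absorbs the coefficient 2k + 1. *)
Lemma chebyshevT_derivn_at1 (R : realType) (n k : nat) :
  (chebyshevT R n)^`(k.+1).[1] * (odd_double_factorial k.+1)%:R
  = (n%:R ^+ 2 - k%:R ^+ 2)
    * ((chebyshevT R n)^`(k).[1] * (odd_double_factorial k)%:R).
Proof.
have -> : odd_double_factorial k.+1 = ((2 * k + 1) * odd_double_factorial k)%N.
  rewrite /odd_double_factorial big_nat_recr //= mulnC; congr muln.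
  by rewrite mulnS addSn subSS subn0 add1n addn1.
rewrite natrM natrD natrM mulrCA !mulrA; congr (_ * _).
by apply: (eq_from_sub (esym (chebyshevT_ode_horner R n k 1))); ring.
Qed.

Lemma chebyshevT_derivn_at1_gt0 (R : realType) (n k : nat) :
  (k <= n)%N -> 0 < (chebyshevT R n)^`(k).[1] * (odd_double_factorial k)%:R.
Proof.
elim: k => [_|k IH kn].
  by rewrite derivn0 chebyshevT_at1 /odd_double_factorial big_geq // mulr1.
rewrite chebyshevT_derivn_at1 mulr_gt0 ?IH 1?ltnW // subr_gt0.
by rewrite ltr_pXn2r // ?nnegrE // ltr_nat.
Qed.

Lemma chebyshevT_at0 (R : realType) (n : nat) :
  (chebyshevT R n.+1).[0] ^+ 2 = 1 - (chebyshevT R n).[0] ^+ 2.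
Proof.
rewrite -cos_pihalf !chebyshevTP -[n.+1%:R]natr1 (mulrDl _ _ (pi / 2)) mul1r.
by rewrite cosD cos_pihalf sin_pihalf mulr0 mulr1 sub0r sqrrN sin2cos2.
Qed.

(** At x = 0 the first-order term vanishes, leaving a two-step recursion parallel to [step2_prodSS].
    Squares remove the sign, and the parity of n enters through T_n(0)^2. *)
Lemma chebyshevT_derivn_at0 (R : realType) (n k : nat) :
  ((chebyshevT R n)^`(k).[0] * step2_prod n k) ^+ 2
  = (if odd k then 1 - (chebyshevT R n).[0] ^+ 2 else (chebyshevT R n).[0] ^+ 2)
    * ((chebyshevT R n)^`(k).[1] * (odd_double_factorial k)%:R) ^+ 2.
Proof.
set e := (chebyshevT R n).[0] ^+ 2.
pose P k := ((chebyshevT R n)^`(k).[0] * step2_prod n k) ^+ 2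
  = (if odd k then 1 - e else e)
    * ((chebyshevT R n)^`(k).[1] * (odd_double_factorial k)%:R) ^+ 2.
suff: P k /\ P k.+1 by case.
have v1 : (chebyshevT R n)^`(0).[1] * (odd_double_factorial 0)%:R = 1.
  by rewrite derivn0 chebyshevT_at1 /odd_double_factorial big_geq // mulr1.
elim: k => [|k [IH0 IH1]]; rewrite /P.
  rewrite chebyshevT_derivn_at1 v1 /step2_prod big_nat1 big_geq //=.
  split; first by rewrite !mulr1 expr1n mulr1.
  have [H _] := chebyshevT_deriv R n.
  have := congr1 (fun p : {poly R} => p.[0]) H.
  rewrite -!polyC_natr !(hornerD, hornerN, hornerM, hornerC, hornerX, hornerXn).
  move=> {}H; have -> : (chebyshevT R n)^`(1).[0] = - (n%:R * (chebyshevT R n.+1).[0]).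
    by apply: (eq_from_sub H); rewrite derivn1; ring.
  rewrite [LHS](_ : _ = (chebyshevT R n.+1).[0] ^+ 2 * n%:R ^+ 4); last by ring.
  by rewrite chebyshevT_at0 -/e; ring.
split=> //.
rewrite [odd k.+2]/= negbK step2_prodSS !chebyshevT_derivn_at1.
have -> : (chebyshevT R n)^`(k.+2).[0]
   = - (n%:R ^+ 2 - k%:R ^+ 2) * (chebyshevT R n)^`(k).[0].
  by apply: (eq_from_sub (chebyshevT_ode_horner R n k 0)); ring.
move: IH0; rewrite /P; set u := _ * step2_prod n k; set v := _ * _%:R => H.
rewrite [LHS](_ : _ = ((n%:R ^+ 2 - k%:R ^+ 2) * (n%:R ^+ 2 - k.+1%:R ^+ 2)) ^+ 2
   * u ^+ 2); last by rewrite /u; ring.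
by rewrite H; ring.
Qed.

(** * The energy: its size at 0 and its monotonicity *)

(** The two squares carry weights in [0, 1] with sum 1, so each coefficient is bounded separately:
    the first equals n^2 - k^2 - k, the second is controlled by [step2_prod_sqr_le]. *)
Lemma energy_at0_le (R : realType) (n k : nat) : (k.+1 < n)%N ->
  ((n%:R ^+ 2 - k.+1%:R ^+ 2 + k.+1%:R) * (chebyshevT R n)^`(k.+1).[0] ^+ 2
    + (chebyshevT R n)^`(k.+2).[0] ^+ 2) * step2_prod n k.+1 ^+ 2
  <= (n%:R ^+ 2 - k%:R ^+ 2)
     * ((chebyshevT R n)^`(k.+1).[1] * (odd_double_factorial k.+1)%:R) ^+ 2.
Proof.
move=> kn; have Pk1 := chebyshevT_derivn_at0 R n k.+1.
have := chebyshevT_derivn_at0 R n k.+2.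
have := step2_prod_sqr_le R n k (ltnW (ltnW kn)).
rewrite step2_prodSS chebyshevT_derivn_at1 -/(step2_prod n k.+1).
move: Pk1; set e := (chebyshevT R n).[0] ^+ 2.
have e0 : 0 <= e by exact: sqr_ge0.
have e1 : e <= 1 by rewrite -subr_ge0 -chebyshevT_at0 sqr_ge0.
rewrite [odd k.+2]/= negbK [odd k.+1]/=.
set a := (chebyshevT R n)^`(k.+1).[0]; set b := (chebyshevT R n)^`(k.+2).[0].
set c := _.[1] * _; set p := step2_prod n k; set q := step2_prod n k.+1.
have kn1 : k.+1%:R < n%:R :> R by rewrite ltr_nat.
set N := n%:R ^+ 2 - k.+1%:R ^+ 2; have N0 : 0 < N.
  by rewrite subr_gt0 ltr_pXn2r // ?nnegrE.
set f := if ~~ odd k then _ else _; set f' := if odd k then _ else _.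
have -> : f' = 1 - f by rewrite /f /f'; case: odd => //=; ring.
have f01 : 0 <= f <= 1 by rewrite /f; case: odd => /=; lra.
move=> Ha Hq Hb.
(* [N ^+ 2] cancels: it comes from [step2_prodSS] on the left and from [chebyshevT_derivn_at1] on
   the right. *)
have {}Hb : b ^+ 2 * p ^+ 2 = (1 - f) * c ^+ 2.
  apply: (@mulIf _ (N ^+ 2)); first by rewrite expf_neq0 // gt_eqF.
  by apply: (eq_from_sub Hb); ring.
have H1 : b ^+ 2 * q ^+ 2 <= (n%:R ^+ 2 - k%:R ^+ 2) * ((1 - f) * c ^+ 2).
  by rewrite -Hb [leRHS]mulrCA ler_wpM2l ?sqr_ge0.
have H2 : (N + k.+1%:R) * (f * c ^+ 2) <= (n%:R ^+ 2 - k%:R ^+ 2) * (f * c ^+ 2).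
  apply: ler_wpM2r.
    by apply: mulr_ge0; [case/andP: f01 | exact: sqr_ge0].
  have : 0 <= k%:R :> R by [].
  by rewrite /N -natr1; nra.
rewrite mulrDl -[_ * a ^+ 2 * _]mulrA -exprMn Ha; move: H1 H2; lra.
Qed.

(* The energy phi u^2 + u'^2 for k = m + 1, cleared of denominators; N stands
   for n^2 - k^2. *)
Definition energy {R : realType} (p : {poly R}) (m : nat) (N : R) : {poly R} :=
  (1 - 'X^2) ^+ m *
  ((N%:P * (1 - 'X^2) + m.+1%:R) * p ^+ 2
   - 2 * m.+1%:R * 'X * (1 - 'X^2) * p * p^`() + (1 - 'X^2) ^+ 2 * p^`() ^+ 2).

Lemma deriv_onesubX2_exp (R : realType) (m : nat) :
  (1 - 'X^2) * ((1 - 'X^2) ^+ m)^`()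
  = - (2 * m%:R * 'X * (1 - 'X^2) ^+ m) :> {poly R}.
Proof.
rewrite deriv_exp; case: m => [|m]; first by rewrite mulr0n; ring.
rewrite /= [(1 - 'X^2) ^+ m.+1]exprS -mulr_natr.
have -> : (1 - 'X^2)^`() = - (2 * 'X) :> {poly R}.
  by rewrite -polyC1 !poly.derivE; ring.
by ring.
Qed.

(** This is (phi u^2 + u'^2)' = phi' u^2 rewritten in the variable x. *)
Lemma energy_deriv (R : realType) (p : {poly R}) (m : nat) (N : R) :
  (1 - 'X^2) * p^`()^`() - (2 * m.+1%:R + 1) * 'X * p^`() + N%:P * p = 0 ->
  (1 - 'X^2) * (energy p m N)^`()
  = - (2 * m%:R * m.+1%:R * 'X * (1 - 'X^2) ^+ m * p ^+ 2).
Proof.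
move=> ode; rewrite /energy; set Q := (X in (_ ^+ _ * X)^`()).
have HQ : Q^`() = - (2 * N%:P * 'X * p ^+ 2)
    + 2 * (N%:P * (1 - 'X^2) + m.+1%:R) * p * p^`()
    - 2 * m.+1%:R * ((1 - 'X^2) * p * p^`() - 2 * 'X ^+ 2 * p * p^`()
       + 'X * (1 - 'X^2) * p^`() ^+ 2 + 'X * (1 - 'X^2) * p * p^`()^`())
    - 4 * 'X * (1 - 'X^2) * p^`() ^+ 2 + 2 * (1 - 'X^2) ^+ 2 * p^`() * p^`()^`().
  rewrite /Q -!polyC_natr !(poly.derivE, deriv_exp) /= !polyC_natr.
  by ring.
rewrite derivM mulrDr mulrA deriv_onesubX2_exp HQ /Q.
move: ode; set w := 1 - 'X^2; set W := w ^+ m => ode.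
(* Up to a power of w, the factor 2 w p' - 2 (m+1) x p is twice the x-derivative of u. *)
apply: (eq_from_sub (congr1 (fun z => w * W *
  (2 * w * p^`() - 2 * m.+1%:R * 'X * p) * z) ode)).
by rewrite /w -!natr1; ring.
Qed.

(** On (-1, 1) the product of x and the derivative of the energy is at most 0; the mean value
    theorem then compares x with 0 on either side. *)
Lemma energy_le (R : realType) (p : {poly R}) (m : nat) (N x : R) :
  (1 - 'X^2) * p^`()^`() - (2 * m.+1%:R + 1) * 'X * p^`() + N%:P * p = 0 ->
  x ^+ 2 < 1 -> (energy p m N).[x] <= (energy p m N).[0].
Proof.
move=> /energy_deriv ode x1.
have sgn c : c ^+ 2 < 1 -> 0 <= - (c * (energy p m N)^`().[c]).
  move=> c1; have w0 : 0 < 1 - c ^+ 2 by rewrite subr_gt0.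
  have := congr1 (fun q : {poly R} => q.[c]) ode.
  rewrite -!polyC_natr !(hornerD, hornerN, hornerM, hornerC, hornerX,
    hornerXn, horner_exp).
  rewrite -expr2 => H; rewrite -(pmulr_rge0 _ w0).
  rewrite [leRHS](_ : _ = 2 * m%:R * m.+1%:R * (1 - c ^+ 2) ^+ m * (c * p.[c]) ^+ 2).
    apply: mulr_ge0; last exact: sqr_ge0.
    by apply: mulr_ge0; [rewrite !mulr_ge0 | apply: exprn_ge0; exact: ltW].
  by rewrite mulrN mulrCA H; ring.
have [x0|x0|-> //] := ltrgt0P x.
  have [c] := polyrcf.poly_mvt (energy p m N) x0.
  rewrite in_itv /= => /andP[c0 cx] e; have /sgn : c ^+ 2 < 1 by nra.
  rewrite -mulrN pmulr_rge0 // oppr_ge0 => H; rewrite -subr_le0 e subr0.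
  by rewrite mulr_le0_ge0 // ltW.
have [c] := polyrcf.poly_mvt (energy p m N) x0.
rewrite in_itv /= => /andP[xc c0] e; have /sgn : c ^+ 2 < 1 by nra.
rewrite -mulNr pmulr_rge0 ?oppr_gt0 // => H; rewrite -subr_ge0 e sub0r.
by rewrite mulr_ge0 // oppr_ge0 ltW.
Qed.

(** * Keeping the zeros away from 1 *)

Lemma size_chebyshevT_derivn (R : realType) (n k : nat) :
  (k <= n)%N -> (size (chebyshevT R n)^`(k) <= (n - k).+1)%N.
Proof.
elim: k => [|k IH] kn; first by rewrite derivn0 subn0 size_chebyshevT.
rewrite derivnS polyorder.size_deriv; have := IH (ltnW kn).
by rewrite subnS prednK ?subn_gt0 //; case: size.
Qed.

(** The distinct roots found by Rolle's theorem exhaust the degree. That [x] is a simple root is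
    recorded by [x \notin s], so the cofactor does not vanish there. *)
Lemma chebyshevT_derivn_factor (R : realType) (n k : nat) (x : R) :
  (k <= n)%N -> root (chebyshevT R n)^`(k) x ->
  exists (c : R) (s : seq R),
    [/\ size s = (n - k).-1, c != 0, x \notin s
      & (chebyshevT R n)^`(k) = c%:P * (('X - x%:P) * \prod_(z <- s) ('X - z%:P))].
Proof.
move=> kn; have [s [ss sor rs]] := chebyshevT_derivn_roots R n k.
have us : uniq s.
  apply: sorted_uniq sor => [a b c /= ba ad|a /=]; last by rewrite ltxx.
  exact: lt_trans ad ba.
have g0 := @chebyshevT_derivn_neq0 R n k kn.
have sg := size_chebyshevT_derivn R n k kn.
set g := (chebyshevT R n)^`(k) in g0 rs sg *.
have ge : g = lead_coef g *: \prod_(z <- s) ('X - z%:P).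
  apply: all_roots_prod_XsubC; rewrite ?uniq_rootsE //.
  by apply/eqP; rewrite eqn_leq max_poly_roots // andbT ss.
move=> gx; have xs : x \in s.
  by move: gx; rewrite ge rootZ ?lead_coef_eq0 // root_prod_XsubC.
exists (lead_coef g), (rem x s); split.
- by rewrite size_rem // ss.
- by rewrite lead_coef_eq0.
- by rewrite mem_rem_uniqF.
- by rewrite {1}ge (perm_big _ (perm_to_rem xs)) big_cons mul_polyC.
Qed.

(** Writing T_n^(k+1) = c (X - x) q, its next three derivatives at x are c q, 2 c q' and 3 c q''.
    The differential equation at orders k+1 and k+2 yields q'/q and q''/q there, which are inserted
    into Laguerre's inequality for q, of degree d. *)
Lemma chebyshevT_derivn_zero_bound (R : realType) (n k d : nat) (x : R) :
  n = (k.+2 + d)%N -> root (chebyshevT R n)^`(k.+1) x ->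
  x ^+ 2 * ((2 * k%:R + 3) * (d%:R * (2 * k%:R + 11) + 3 * (2 * k%:R + 3)))
  <= 4 * d%:R * (n%:R ^+ 2 - (k%:R + 2) ^+ 2) * (1 - x ^+ 2).
Proof.
move=> nE gx; have kn : (k.+1 <= n)%N by rewrite nE; lia.
have [c [s [ss c0 xs gE]]] := @chebyshevT_derivn_factor R n k.+1 x kn gx.
have {}ss : size s = d by rewrite ss nE; lia.
pose q : {poly R} := \prod_(z <- s) ('X - z%:P).
have q0 : q.[x] != 0 by rewrite -rootE root_prod_XsubC.
have := laguerre_prod_XsubC R s q x erefl; rewrite ss.
have G1 : (chebyshevT R n)^`(k.+2) = c%:P * (q + ('X - x%:P) * q^`()).
  by rewrite derivnS gE deriv_mulC derivM derivXsubC mul1r.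
have G2 : (chebyshevT R n)^`(k.+3)
    = c%:P * (2%:P * q^`() + ('X - x%:P) * q^`()^`()).
  rewrite derivnS G1 deriv_mulC derivD derivM derivXsubC mul1r polyC_natr.
  by congr (_ * _); ring.
have G3 : (chebyshevT R n)^`(k.+4)
    = c%:P * (3%:P * q^`()^`() + ('X - x%:P) * q^`()^`()^`()).
  rewrite derivnS G2 deriv_mulC derivD deriv_mulC derivM derivXsubC mul1r !polyC_natr.
  by congr (_ * _); ring.
have := chebyshevT_ode_horner R n k.+2 x.
have := chebyshevT_ode_horner R n k.+1 x.
rewrite gE G1 G2 G3 !(hornerM, hornerD, hornerN, hornerC, hornerX) -/q.
rewrite -[k.+2%:R]natr1 -[k.+1%:R]natr1.
move: (q.[x]) (q^`().[x]) (q^`()^`().[x]) (q^`()^`()^`().[x]) q0 => a b e f a0 H1 H2 L.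
set w := 1 - x ^+ 2.
have {}H1 : 2 * w * b = (2 * k%:R + 3) * x * a.
  by apply: (mulfI c0); apply: (eq_from_sub H1); rewrite /w; ring.
have {}H2 : 3 * w * e = 2 * (2 * k%:R + 5) * x * b
    - (n%:R ^+ 2 - (k%:R + 2) ^+ 2) * a.
  by apply: (mulfI c0); apply: (eq_from_sub H2); rewrite /w; ring.
have a2 : 0 < a ^+ 2 by rewrite exprn_even_gt0.
rewrite -subr_ge0 -(pmulr_rge0 _ a2).
(* The factor 12 w^2 clears the denominators 2 w of q' (squared) and 3 w of q''. *)
have -> : a ^+ 2 * (4 * d%:R * (n%:R ^+ 2 - (k%:R + 2) ^+ 2) * w
     - x ^+ 2 * ((2 * k%:R + 3) * (d%:R * (2 * k%:R + 11) + 3 * (2 * k%:R + 3))))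
  = 12 * w ^+ 2 * ((d%:R - 1) * b ^+ 2 - d%:R * (a * e)).
  rewrite [RHS](_ : _ = 3 * (d%:R - 1) * (2 * w * b) ^+ 2
    - 4 * d%:R * a * w * (3 * w * e)); last by ring.
  rewrite H2 [RHS](_ : _ = 3 * (d%:R - 1) * (2 * w * b) ^+ 2
    - 4 * d%:R * a * ((2 * k%:R + 5) * x * (2 * w * b)
      - (n%:R ^+ 2 - (k%:R + 2) ^+ 2) * a * w)); last by ring.
  by rewrite H1; ring.
by rewrite mulr_ge0 ?subr_ge0 // mulr_ge0 ?sqr_ge0.
Qed.

(** * Quantitative slack and conclusion *)

(** The zero bound reads 1 - omega^2 >= K / L. With r = (n/(k+2))^2, the claim is (r K / L - 1) (n^2
    - k^2 + k) >= 1, the margin that Bernoulli's inequality will use. *)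
Lemma zero_bound_slack (R : realFieldType) (k d n K L : R) :
  1 <= k -> 1 <= d -> n = k + 2 + d ->
  K = (2 * k + 3) * (d * (2 * k + 11) + 3 * (2 * k + 3)) ->
  L = 4 * d * (n ^+ 2 - (k + 2) ^+ 2) + K ->
  (k + 2) ^+ 2 * L
  <= (K * n ^+ 2 - L * (k + 2) ^+ 2) * (n ^+ 2 - k ^+ 2 + k).
Proof.
move=> k1 d1 nE KE LE.
(* Here n^2 = N0 + M, K = J + 4 d M, and G is the last factor of the goal. *)
pose J := d * (12 * k + 17) + 3 * (2 * k + 3) ^+ 2.
pose N0 := d * (2 * k + 4 + d); pose G := N0 + 5 * k + 4; pose M := (k + 2) ^+ 2.
have N0ge : 2 * k + 5 <= N0 by rewrite /N0; nra.
have JM : 8 * M <= J by rewrite /J /M; nra.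
have M0 : 0 < M by rewrite /M; nra.
have NG : 2 * M <= N0 * G by rewrite /G /M; nra.
have nG : d * n ^+ 2 <= N0 * G.
  have Gn : n <= G by rewrite /G /N0 nE; nra.
  have -> : d * n ^+ 2 = n * d * n by ring.
  have -> : N0 * G = (n + (k + 2)) * d * G by rewrite /N0 nE; ring.
  have n0 : 0 <= n by lra.
  apply: ler_pM => //; first by rewrite mulr_ge0 //; lra.
  by rewrite ler_wpM2r //; lra.
rewrite -subr_ge0.
(* The claim reduces to J N0 G >= M (J + 4 d n^2); half of the left side pays for each term on the
   right. *)
rewrite [leRHS](_ : _ = 2^-1 * (J * (N0 * G - 2 * M))
  + (2^-1 * (N0 * G * (J - 8 * M)) + 4 * M * (N0 * G - d * n ^+ 2))); last first.
  by rewrite LE KE /J /G /N0 /M nE; field.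
have J0 : 0 <= J by lra.
have NG0 : 0 <= N0 * G by lra.
have h0 : 0 <= 2^-1 :> R by rewrite invr_ge0.
have M40 : 0 <= 4 * M by lra.
apply: addr_ge0.
  by apply: mulr_ge0 => //; apply: mulr_ge0 => //; rewrite subr_ge0.
apply: addr_ge0; last by apply: mulr_ge0 => //; rewrite subr_ge0.
by apply: mulr_ge0 => //; apply: mulr_ge0 => //; rewrite subr_ge0.
Qed.

Theorem corollary1p3 (R : realType) (n k : nat) (hk : (1 <= k)%N)
    (hn : (k + 1 < n)%N) :
  tau R n k <=
    (odd_double_factorial k)%:R
      / (\prod_(1 <= j < k.+1) (n%:R + k%:R + 1 - 2 * j%:R))
      * (n%:R / (k%:R + 2)) ^+ k.
Proof.
case: k hk hn => // m _; rewrite addn1 => hn.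
(* With k = m + 1, d counts the zeros of T_n^(k+1) other than omega. *)
have [d nE] : exists d, n = (m.+3 + d)%N by exists (n - m.+3)%N; lia.
have [wroot _] := @omegaP R n m.+1 hn.
rewrite /tau; move: (omega R n m.+1) wroot => x gx.
have zb := chebyshevT_derivn_zero_bound R n m.+1 d x nE gx.
have mn : (m.+1 <= n)%N by lia.
have c0 := chebyshevT_derivn_at1_gt0 R n m.+1 mn.
have q0 : 0 < step2_prod n m.+1 :> R by exact: step2_prod_gt0.
have o0 : 0 < (odd_double_factorial m.+1)%:R :> R.
  rewrite ltr0n /odd_double_factorial big_nat; apply: prodn_cond_gt0 => j.
  by rewrite subn_gt0; lia.
have t0 : 0 < (chebyshevT R n)^`(m.+1).[1] by rewrite -(pmulr_lgt0 _ o0).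
(* Squaring removes the absolute value and matches the energy, which is quadratic in f. *)
suff main : ((chebyshevT R n)^`(m.+1).[x] * step2_prod n m.+1) ^+ 2
  <= ((chebyshevT R n)^`(m.+1).[1] * (odd_double_factorial m.+1)%:R) ^+ 2
     * ((n%:R / (m.+1%:R + 2)) ^+ 2) ^+ m.+1.
  rewrite -/(step2_prod n m.+1) ler_pdivrMr //.
  rewrite [leRHS](_ : _ = (chebyshevT R n)^`(m.+1).[1] * (odd_double_factorial m.+1)%:R
    * (n%:R / (m.+1%:R + 2)) ^+ m.+1 / step2_prod n m.+1); last by ring.
  rewrite ler_pdivlMr // -[X in _ * X]gtr0_norm // -normrM.
  have r0 : 0 <= (chebyshevT R n)^`(m.+1).[1] * (odd_double_factorial m.+1)%:R
    * (n%:R / (m.+1%:R + 2)) ^+ m.+1.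
    apply: mulr_ge0; first exact: ltW.
    by apply: exprn_ge0; apply: divr_ge0; rewrite ?addr_ge0.
  rewrite -[leRHS]ger0_norm // -ler_sqr ?nnegrE // !real_normK ?num_real //.
  by rewrite [leRHS]exprMn exprAC.
set c := _.[1] * _ in c0 *; set q := step2_prod n m.+1 in q0 *.
set f := (chebyshevT R n)^`(m.+1).
(* If d = 0, the zero bound forces x = 0 and n/(k+2) = 1, so the closed form at 0 suffices. *)
have [d0|d_gt0] := posnP d.
  have -> : x = 0.
    apply/eqP; rewrite -sqrf_eq0 eq_le sqr_ge0 andbT.
    by move: zb; rewrite d0 mulr0 !mul0r add0r pmulr_lle0.
  have -> : n%:R / (m.+1%:R + 2) = 1 :> R.
    by rewrite nE d0 -natrD addn2 addn0 divff // pnatr_eq0.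
  rewrite !expr1n mulr1 chebyshevT_derivn_at0 -/c ler_piMl ?sqr_ge0 //.
  have := sqr_ge0 (chebyshevT R n.+1).[0]; rewrite chebyshevT_at0.
  have := sqr_ge0 (chebyshevT R n).[0]; case: odd; lra.
have d1 : 1 <= d%:R :> R by rewrite ler1n.
have k1 : 1 <= m.+1%:R :> R by rewrite ler1n.
have nE' : n%:R = m.+1%:R + 2 + d%:R :> R.
  by rewrite nE -natrD addn2 natrD.
have fin := zero_bound_slack R m.+1%:R d%:R n%:R _ _ k1 d1 nE' erefl erefl.
pose N : R := n%:R ^+ 2 - m.+1%:R ^+ 2.
have E0 : (energy f m N).[0] * q ^+ 2 <= (n%:R ^+ 2 - m%:R ^+ 2) * c ^+ 2.
  have := energy_at0_le R n m (ltnW hn); rewrite -/q -/c.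
  apply: le_trans; rewrite le_eqVlt; apply/orP; left; apply/eqP.
  rewrite /energy -!polyC_natr.
  rewrite !(hornerD, hornerN, hornerM, hornerC, hornerX,
    hornerXn, horner_exp).
  rewrite -derivnS -/f /N [1 - _](_ : _ = 1 :> R) ?expr1n; last by ring.
  by ring.
have Ex : (energy f m N).[x]
    = (1 - x ^+ 2) ^+ m * (N * (1 - x ^+ 2) + m.+1%:R) * f.[x] ^+ 2.
  rewrite /energy -!polyC_natr.
  rewrite !(hornerD, hornerN, hornerM, hornerC, hornerX,
    hornerXn, horner_exp).
  by rewrite -derivnS (rootP gx); ring.
set K := (2 * m.+1%:R + 3) * _ in zb fin.
set N0 := n%:R ^+ 2 - (m.+1%:R + 2) ^+ 2 in zb fin.
have K0 : 0 < K.
  by rewrite /K; apply: mulr_gt0; [lra | nra].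
have N00 : 0 <= N0 by rewrite /N0 nE'; nra.
have dN0 : 0 <= 4 * d%:R * N0 by rewrite mulr_ge0 //; lra.
(* Otherwise the zero bound would have a positive left side and a nonpositive right side. *)
have w0 : 0 < 1 - x ^+ 2.
  rewrite ltNge; apply/negP => w0; have := mulr_ge0_le0 dN0 w0.
  have : 0 < x ^+ 2 * K by apply: mulr_gt0 => //; lra.
  by move: zb; lra.
have x1 : x ^+ 2 < 1 by rewrite -subr_gt0.
have Ele : (energy f m N).[x] <= (energy f m N).[0].
  apply: energy_le x1; rewrite -!derivnS -[RHS](chebyshevT_ode R n m.+1).
  by rewrite /N polyCB !polyC_exp !polyC_natr.
set w := 1 - x ^+ 2 in zb w0 Ex; set r := (n%:R / _) ^+ 2.
pose M : R := (m.+1%:R + 2) ^+ 2; pose G := N + m.+1%:R.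
have M0 : 0 < M by rewrite exprn_gt0 // addr_gt0.
have n0 : 0 < n%:R :> R by rewrite ltr0n (leq_trans _ hn).
have r0 : 0 < r by rewrite exprn_gt0 // divr_gt0 // addr_gt0.
have rE : r * M = n%:R ^+ 2 by rewrite /r exprMn exprVn divfK // gt_eqF.
have N1 : 0 < N by rewrite /N nE'; nra.
have G0 : 0 < G by rewrite /G; lra.
(* With L = 4 d N0 + K, the zero bound is L w >= K, so [zero_bound_slack] applies. *)
have y1 : 1 <= (w * r - 1) * G.
  have L0 : 0 < 4 * d%:R * N0 + K by lra.
  rewrite -(ler_pM2l M0) mulr1 -(ler_pM2l L0) [leLHS]mulrC (le_trans fin) //.
  rewrite [leRHS](_ : _ = ((4 * d%:R * N0 + K) * w * n%:R ^+ 2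
    - (4 * d%:R * N0 + K) * M) * G); last by rewrite -rE; ring.
  apply: ler_wpM2r; first exact: ltW.
  rewrite lerD2r; apply: ler_wpM2r; first exact: sqr_ge0.
  by move: zb; rewrite /w; lra.
(* Bernoulli and [y1] give G (w r)^(m+1) >= G + m + 1, which is n^2 - m^2 + 1. *)
have bern : n%:R ^+ 2 - m%:R ^+ 2 <= G * (w * r) ^+ m.+1.
  have y0 : -1 <= w * r - 1 by rewrite lerBrDl subrr mulr_ge0 // ltW.
  have := bernoulli_ineq R _ m.+1 y0; rewrite [1 + (w * r - 1)]addrC subrK.
  move=> /(ler_wpM2l (ltW G0)); apply: le_trans.
  have m0 : 0 <= m.+1%:R :> R by [].
  have := ler_wpM2l m0 y1.
  by rewrite /G /N -natr1; lra.
have w1 : w <= 1 by rewrite /w gerBl sqr_ge0.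
have wG : w ^+ m.+1 * G <= w ^+ m * (N * w + m.+1%:R).
  rewrite exprSr -mulrA; apply: ler_wpM2l; first by rewrite exprn_ge0 // ltW.
  rewrite -subr_ge0 [leRHS](_ : _ = m.+1%:R * (1 - w)); last by rewrite /G; ring.
  by rewrite mulr_ge0 // subr_ge0.
(* The chain is w^(m+1) G (f(x) q)^2 <= E(x) q^2 <= E(0) q^2 <= (n^2 - m^2) c^2 <= G (w r)^(m+1)
   c^2, with E the energy; then w^(m+1) G cancels. *)
have := ler_wpM2r (sqr_ge0 q) Ele => /le_trans /(_ E0).
rewrite Ex (_ : _ * q ^+ 2 = w ^+ m * (N * w + m.+1%:R) * (f.[x] * q) ^+ 2); last by ring.
move=> /(le_trans (ler_wpM2r (sqr_ge0 _) wG)).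
move=> /le_trans /(_ (ler_wpM2r (sqr_ge0 c) bern)).
have W0 : 0 < w ^+ m.+1 * G by rewrite mulr_gt0 ?exprn_gt0.
move=> H; rewrite -(ler_pM2l W0) (le_trans H) // exprMn.
by rewrite [leRHS](_ : _ = G * (w ^+ m.+1 * r ^+ m.+1) * c ^+ 2) //; ring.
Qed.
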